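(* Let $(X,\mathcal{A},\mu)$ be a measure space and let $I\neq J$ be two ideals (not necessarily proper) in $\mathcal{M}(X,\mathcal{A})$. Then the $U_\mu^I$-topology is different from the $U_\mu^J$-topology, and the $m_\mu^I$-topology is different from the $m_\mu^J$-topology, on $\mathcal{M}(X,\mathcal{A})$.
   Context: $X$ is a non-empty set, $\mathcal{A}$ a $\sigma$-algebra on $X$, $\mu:\mathcal{A}\to[0,\infty]$ a measure. $\mathcal{M}(X,\mathcal{A})$ is the commutative ring of all measurable functions $X\to\mathbb{R}$ under pointwise operations. A $\mu$-null set is a set $E\in\mathcal{A}$ with $\mu(E)=0$. A positive unit of $\mathcal{M}(X,\mathcal{A})$ is a $u\in\mathcal{M}(X,\mathcal{A})$ with $u(x)>0$ for all $x\in X$. For an ideal $I$ of $\mathcal{M}(X,\mathcal{A})$, $f\in\mathcal{M}(X,\mathcal{A})$, real $\epsilon>0$ and a positive unit $u$, put $U_\mu(f,I,\epsilon)=\{g\in\mathcal{M}(X,\mathcal{A}): g-f\in I$ and $\sup_{x\in X\setminus E}|f(x)-g(x)|<\epsilon$ for some $\mu$-null set $E\}$ (supremum taken in $[0,\infty]$) and $m_\mu(f,I,u)=\{g\in\mathcal{M}(X,\mathcal{A}): g-f\in I$ and there is a $\mu$-null set $E$ with $|f(x)-g(x)|<u(x)$ for all $x\in X\setminus E\}$. The sets $U_\mu(f,I,\epsilon)$ form an open base of the $U_\mu^I$-topology on $\mathcal{M}(X,\mathcal{A})$, and the sets $m_\mu(f,I,u)$ form an open base of the $m_\mu^I$-topology.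 *)

(* Defs.v *)
From HB Require Import structures.
From mathcomp Require Import all_boot all_order all_algebra.
From mathcomp Require Import all_classical all_reals all_analysis measurable_realfun.
From mathcomp Require Import lra.
Import Order.TTheory GRing.Theory Num.Theory.
Import numFieldNormedType.Exports.

Set Implicit Arguments.
Unset Strict Implicit.
Unset Printing Implicit Defensive.

Local Open Scope classical_set_scope.
Local Open Scope ring_scope.

(* Ideals of a commutative ring; unlike [idealr] in [ring_quotient], the whole
   ring is allowed. *)
Record ideal (A : comPzRingType) := Ideal {
  ideal_set :> set A ;
  ideal0 : ideal_set 0 ;
  idealD : forall a b, ideal_set a -> ideal_set b -> ideal_set (a + b) ;
  idealM : forall a b, ideal_set b -> ideal_set (a * b)
}.

Section definitions.
Context d (X : measurableType d) (R : realType).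
Variable mu : {measure set X -> \bar R}.
Local Notation M := {mfun X >-> R}.

Definition mu_null (E : set X) : Prop := measurable E /\ mu E = 0%E.

Definition positive_unit (u : M) : Prop := forall x, 0 < u x.

(* Supremum of |f - g| off E, taken in [0, +oo]: joining with 0 only matters
   when E is all of X, since [ereal_sup set0 = -oo]. *)
Definition dist_off (E : set X) (f g : M) : \bar R :=
  maxe 0%E (ereal_sup [set (`|f x - g x|)%:E | x in ~` E]).

Definition U_ball (I : ideal M) (f : M) (e : R) : set M :=
  [set g | ideal_set I (g - f) /\ exists2 E, mu_null E & (dist_off E f g < e%:E)%E].

Definition m_ball (I : ideal M) (f u : M) : set M :=
  [set g | ideal_set I (g - f) /\
    exists2 E, mu_null E & forall x, (~` E) x -> `|f x - g x| < u x].

Definition U_base (I : ideal M) : set_system M :=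
  [set B | exists f e, 0 < e /\ B = U_ball I f e].

Definition m_base (I : ideal M) : set_system M :=
  [set B | exists f u, positive_unit u /\ B = m_ball I f u].

Lemma mu_null0 : mu_null set0.
Proof. by split; [exact: measurable0|exact: measure0]. Qed.

Lemma mu_nullU E F : mu_null E -> mu_null F -> mu_null (E `|` F).
Proof.
move=> [mE E0] [mF F0]; split; first exact: measurableU.
by rewrite measureU0.
Qed.

Lemma dist_off_lt E (f g : M) (e : R) :
  (dist_off E f g < e%:E)%E <->
  exists s, [/\ 0 <= s, s < e & forall x, (~` E) x -> `|f x - g x| <= s].
Proof.
split=> [|[s [s0 se fgs]]]; last first.
  rewrite (@le_lt_trans _ _ s%:E) ?lte_fin// ge_max lee_fin s0/=.
  by apply: ge_ereal_sup => _ [x Ex <-]; rewrite lee_fin fgs.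
have d0 : (0 <= dist_off E f g)%E by rewrite le_max lexx.
move=> dlt; have dfin : dist_off E f g \is a fin_num.
  by rewrite ge0_fin_numE// (lt_trans dlt)// ltry.
exists (fine (dist_off E f g)); split; first exact: fine_ge0.
  by rewrite -lte_fin fineK.
move=> x Ex; rewrite -lee_fin fineK// le_max; apply/orP; right.
by apply: ereal_sup_ubound; exists x.
Qed.

Lemma ideal_sub_trans (I : ideal M) (f g h : M) :
  ideal_set I (g - f) -> ideal_set I (h - g) -> ideal_set I (h - f).
Proof. by move=> fg gh; rewrite -(subrKA g); apply: idealD. Qed.

Lemma U_ball_center (I : ideal M) f e : 0 < e -> U_ball I f e f.
Proof.
move=> e0; split; first by rewrite subrr; exact: ideal0.
exists set0; first exact: mu_null0.
by apply/dist_off_lt; exists 0; split=> // x _; rewrite subrr normr0.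
Qed.

Lemma m_ball_center (I : ideal M) f u : positive_unit u -> m_ball I f u f.
Proof.
move=> u0; split; first by rewrite subrr; exact: ideal0.
exists set0; first exact: mu_null0.
by move=> x _; rewrite subrr normr0.
Qed.

Lemma U_ball_shrink (I : ideal M) f e g : U_ball I f e g ->
  exists2 r, 0 < r & forall r', r' <= r -> U_ball I g r' `<=` U_ball I f e.
Proof.
move=> [Igf [E E0 /dist_off_lt[s [s0 se fgs]]]].
exists (e - s); first by rewrite subr_gt0.
move=> r' r'es h [Ihg [F F0 /dist_off_lt[t [t0 tr ght]]]].
split; first exact: ideal_sub_trans Ihg.
exists (E `|` F); first exact: mu_nullU.
apply/dist_off_lt; exists (s + t); split; [exact: addr_ge0|by lra|].
move=> x; rewrite setCU => -[Ex Fx].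
by rewrite (le_trans (ler_distD (g x) _ _))// lerD ?fgs ?ght.
Qed.

Lemma m_ball_shrink (I : ideal M) f u g : m_ball I f u g ->
  exists2 w, positive_unit w &
    forall w' : M, (forall x, w' x <= w x) -> m_ball I g w' `<=` m_ball I f u.
Proof.
move=> [Igf [E E0 fgu]].
pose v : M := u - max_mfun (f - g) (g - f).
have vE x : v x = u x - `|f x - g x|.
  change (u x - Num.max (f x - g x) (g x - f x) = u x - `|f x - g x|).
  have [fg|fg] := leP 0 (f x - g x).
    by rewrite ger0_norm// maxEle; case: leP => ?; lra.
  by rewrite ltr0_norm// maxEle; case: leP => ?; lra.
have mv0 : measurable (v @^-1` [set 0]).
  by rewrite -[_ @^-1` _]setTI; exact: (measurable_funP v).
pose w : M := max_mfun v (- v) + indic_mfun _ mv0.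
have wE x : w x = `|v x| + (v x == 0)%:R.
  change (Num.max (v x) (- v x) + \1_(v @^-1` [set 0]) x =
    `|v x| + (v x == 0)%:R).
  rewrite indicE maxrN; congr (_ + (nat_of_bool _)%:R).
  by apply/idP/eqP; rewrite inE.
exists w.
  move=> x; rewrite wE; have [->|v0] := eqVneq (v x) 0.
    by rewrite normr0 add0r.
  by rewrite addr0 normr_gt0.
move=> w' w'w h [Ihg [F F0 ghw]]; split; first exact: ideal_sub_trans Ihg.
exists (E `|` F); first exact: mu_nullU.
move=> x; rewrite setCU => -[Ex Fx].
have := fgu x Ex; rewrite -subr_gt0 -vE => vx0.
have := lt_le_trans (ghw x Fx) (w'w x).
rewrite wE gt_eqF// addr0 (gtr0_norm vx0) vE ltrBrDl.
by apply: le_lt_trans; exact: ler_distD.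
Qed.

Lemma U_base_cover (I : ideal M) : \bigcup_(B in U_base I) B = setT.
Proof.
rewrite -subTset => f _; exists (U_ball I f 1); last exact: U_ball_center.
by exists f, 1; split.
Qed.

Lemma m_base_cover (I : ideal M) : \bigcup_(B in m_base I) B = setT.
Proof.
rewrite -subTset => f _.
have p1 : positive_unit 1 by move=> x; rewrite mfun1.
by exists (m_ball I f 1); [exists f, 1; split|exact: m_ball_center].
Qed.

Lemma U_base_join (I : ideal M) B C g : U_base I B -> U_base I C ->
  B g -> C g -> exists D, [/\ U_base I D, D g & D `<=` B `&` C].
Proof.
move=> [f1 [e1 [_ ->]]] [f2 [e2 [_ ->]]] /U_ball_shrink[r1 r10 s1].
move=> /U_ball_shrink[r2 r20 s2].
have r0 : 0 < Num.min r1 r2 by rewrite lt_min r10.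
exists (U_ball I g (Num.min r1 r2)); split; last by rewrite subsetI; split;
  [apply: s1|apply: s2]; rewrite ge_min lexx ?orbT.
- by exists g, (Num.min r1 r2).
- exact: U_ball_center.
Qed.

Lemma m_base_join (I : ideal M) B C g : m_base I B -> m_base I C ->
  B g -> C g -> exists D, [/\ m_base I D, D g & D `<=` B `&` C].
Proof.
move=> [f1 [u1 [_ ->]]] [f2 [u2 [_ ->]]] /m_ball_shrink[w1 w10 s1].
move=> /m_ball_shrink[w2 w20 s2].
have w0 : positive_unit (min_mfun w1 w2).
  by move=> x; rewrite /= lt_min w10 w20.
exists (m_ball I g (min_mfun w1 w2)); split; last by rewrite subsetI; split;
  [apply: s1|apply: s2] => x; rewrite /= ge_min lexx ?orbT.
- by exists g, (min_mfun w1 w2).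
- exact: m_ball_center.
Qed.

End definitions.

Section topologies.
Context d (X : measurableType d) (R : realType).
Local Notation M := {mfun X >-> R}.

(* Copies of the set of measurable functions, so that each measure and each
   ideal can carry its own topology. *)
Definition U_space (mu : {measure set X -> \bar R}) (I : ideal M) : Type := M.
Definition m_space (mu : {measure set X -> \bar R}) (I : ideal M) : Type := M.

Variables (mu : {measure set X -> \bar R}) (I : ideal M).

HB.instance Definition _ := Choice.on (U_space mu I).
HB.instance Definition _ := isBaseTopological.Build (U_space mu I)
  (@U_base_cover _ _ _ mu I) (@U_base_join _ _ _ mu I).

HB.instance Definition _ := Choice.on (m_space mu I).
HB.instance Definition _ := isBaseTopological.Build (m_space mu I)
  (@m_base_cover _ _ _ mu I) (@m_base_join _ _ _ mu I).

Definition U_topology : set_system M := @open (U_space mu I).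
Definition m_topology : set_system M := @open (m_space mu I).

Lemma U_topologyE :
  U_topology = [set \bigcup_(B in F) B | F in subset^~ (U_base mu I)].
Proof. by []. Qed.

Lemma m_topologyE :
  m_topology = [set \bigcup_(B in F) B | F in subset^~ (m_base mu I)].
Proof. by []. Qed.

End topologies.

(* Main.v *)
Require Import Defs.
From mathcomp Require Import all_boot all_order all_algebra.
From mathcomp Require Import all_classical all_reals all_analysis measurable_realfun.
Import Order.TTheory GRing.Theory Num.Theory.

Local Open Scope classical_set_scope.
Local Open Scope ring_scope.

(* An ideal I is open in its own topology, since the balls of I centred in I
   stay in I. If I is also open in the topology of J, it contains a ball of J
   around 0, hence every small element of J. Every element of J is a unit
   multiple of a small element of J, so J is contained in I; by symmetry, an
   ideal can be recovered from its topology. *)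

Section ideal_topologies.
Context d (X : measurableType d) (R : realType).
Local Notation M := {mfun X >-> R}.
Implicit Types (mu : {measure set X -> \bar R}) (I J : ideal M) (f h u w : M).

(* The scaling unit is exp (ln w - |h|), whose inverse is again an exponential;
   the bound is |h| < exp |h|. *)
Lemma unit_scale_lt h w : positive_unit w ->
  exists c e : M, c * e = 1 /\ forall x, `|(e * h) x| < w x.
Proof.
move=> w0; pose a x := `|h x| - ln (w x).
have ma : measurable_fun setT a.
  apply: measurable_funB; first exact: measurableT_comp.
  exact: (measurableT_comp (@measurable_ln R)).
have mE : measurable_fun setT (expR \o a) by exact: measurableT_comp.
have mEN : measurable_fun setT (expR \o (\- a)).
  by apply: measurableT_comp => //; exact: measurableT_comp.
exists (mfun_Sub (mem_set mE : _ \in mfun)).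
exists (mfun_Sub (mem_set mEN : _ \in mfun)).
split.
  by apply/mfuneqP => x; exact: expRxMexpNx_1.
move=> x; change (`|expR (- a x) * h x| < w x).
rewrite opprB expRD lnK ?posrE// normrM gtr0_norm ?mulr_gt0 ?expR_gt0//.
rewrite -mulrA gtr_pMr// expRN mulrC ltr_pdivrMr ?expR_gt0// mul1r.
by rewrite (lt_le_trans _ (expR_ge1Dx _))// ltrDr.
Qed.

(** Writing [h] as [c * (e * h)] with [e * h] below [w] reduces an inclusion of ideals to elements
    below one positive unit. Both topologies use this reduction. *)
Lemma ideal_sub_small I J w : positive_unit w ->
  (forall h, ideal_set J h -> (forall x, `|h x| < w x) -> ideal_set I h) ->
  ideal_set J `<=` ideal_set I.
Proof.
move=> w0 smallI h Jh; have [c [e [ce1 ehw]]] := unit_scale_lt h w w0.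
rewrite -[h]mul1r -ce1 -mulrA; apply: idealM; apply: smallI => //.
exact: idealM.
Qed.

Lemma ideal_addl I f h : ideal_set I f -> ideal_set I (h - f) -> ideal_set I h.
Proof. by move=> If Ihf; rewrite -(subrK f h); exact: idealD. Qed.

Lemma U_topology_ideal mu I : U_topology mu I (ideal_set I).
Proof.
(* The family of all basic sets inside [I] covers [I]: any radius serves for the ball around [f],
   since only [h - f] in [I] matters. *)
rewrite U_topologyE; exists [set B | U_base mu I B /\ B `<=` ideal_set I].
  by move=> B [].
apply/seteqP; split=> [f [B [_ BI] /BI]//|f If].
exists (U_ball mu I f 1); last exact: U_ball_center.
split; first by exists f, 1.
by move=> h [Ihf _]; exact: ideal_addl Ihf.
Qed.

Lemma m_topology_ideal mu I : m_topology mu I (ideal_set I).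
Proof.
rewrite m_topologyE; exists [set B | m_base mu I B /\ B `<=` ideal_set I].
  by move=> B [].
apply/seteqP; split=> [f [B [_ BI] /BI]//|f If].
have p1 : positive_unit (1 : M) by move=> x; rewrite mfun1.
exists (m_ball mu I f 1); last exact: m_ball_center.
split; first by exists f, 1.
by move=> h [Ihf _]; exact: ideal_addl Ihf.
Qed.

Lemma U_topology_ideal_sub mu I J :
  U_topology mu J (ideal_set I) -> ideal_set J `<=` ideal_set I.
Proof.
rewrite U_topologyE => -[F Fbase FI].
have : (\bigcup_(B in F) B) 0 by rewrite FI; exact: ideal0.
case=> B FB B0; have [f [e [_ Bfe]]] := Fbase B FB.
(* The basic set around [0] may be centred elsewhere; shrinking recentres it at [0]. *)
move: B0; rewrite Bfe => /U_ball_shrink[r r0 /(_ r (lexx r)) rfe].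
(* Pointwise [|h x| < r] would only give a supremum at most [r]; halving makes it strictly
   smaller. *)
have r20 : 0 < r / 2 by rewrite divr_gt0.
apply: (@ideal_sub_small I J (cst (r / 2) : M)) => [//|h Jh hr].
rewrite -FI; exists B => //; rewrite Bfe; apply: rfe; split.
  by rewrite subr0.
exists set0; first exact: mu_null0.
apply/dist_off_lt; exists (r / 2); split; first exact: ltW.
  by rewrite ltr_pdivrMr// ltr_pMr// ltr1n.
by move=> x _; rewrite sub0r normrN; exact/ltW/hr.
Qed.

Lemma m_topology_ideal_sub mu I J :
  m_topology mu J (ideal_set I) -> ideal_set J `<=` ideal_set I.
Proof.
rewrite m_topologyE => -[F Fbase FI].
have : (\bigcup_(B in F) B) 0 by rewrite FI; exact: ideal0.
case=> B FB B0; have [f [u [_ Bfu]]] := Fbase B FB.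
move: B0; rewrite Bfu => /m_ball_shrink[w w0 /(_ w (fun=> lexx _)) wfu].
(* No halving here: membership in an [m_ball] is a pointwise strict bound, so [w] itself serves. *)
apply: (@ideal_sub_small I J w w0) => h Jh hw.
rewrite -FI; exists B => //; rewrite Bfu; apply: wfu; split.
  by rewrite subr0.
exists set0; first exact: mu_null0.
by move=> x _; rewrite sub0r normrN.
Qed.

End ideal_topologies.

Theorem theorem2p1 (d : measure_display) (X : measurableType d) (R : realType)
    (mu : {measure set X -> \bar R}) (I J : ideal {mfun X >-> R})
    (IJ : (I : set {mfun X >-> R}) <> J) :
  U_topology mu I <> U_topology mu J /\ m_topology mu I <> m_topology mu J.
Proof.
split=> top_eq; apply: IJ; apply/seteqP; split.
(* For [I] inside [J], the ideal [J] must be open in the topology of [I], which by [top_eq] is its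
   own. *)
- apply: (@U_topology_ideal_sub _ _ _ mu).
  by rewrite top_eq; exact: U_topology_ideal.
- apply: (@U_topology_ideal_sub _ _ _ mu).
  by rewrite -top_eq; exact: U_topology_ideal.
- apply: (@m_topology_ideal_sub _ _ _ mu).
  by rewrite top_eq; exact: m_topology_ideal.
- apply: (@m_topology_ideal_sub _ _ _ mu).
  by rewrite -top_eq; exact: m_topology_ideal.
Qed.
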